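(* There exists a solvable group $\Gamma \leq \mathrm{Homeo}_{+}(I)$ of solvability degree (derived length) two, generated by two homeomorphisms, such that $h_{\mathrm{strict}}(\Gamma) = \infty$.
   Context: $I=[0,1]$ and $\mathrm{Homeo}_{+}(I)$ is the group of orientation-preserving homeomorphisms of $I$. For a subgroup $G \le \mathrm{Homeo}_+(I)$, an orbital of $G$ is the convex hull of the $G$-orbit of a point of $I$, provided this convex hull contains more than one point; orbitals are open intervals. For $g \in G$, an orbital of $g$ means an orbital of the cyclic group $\langle g\rangle$ (equivalently, a connected component of $I \setminus \mathrm{Fix}(g)$). A signed orbital of $G$ is a pair $(A,g)$ with $g\in G$ and $A$ an orbital of $g$; $g$ is called its signature. A tower $T$ of $G$ is a set of signed orbitals of $G$ such that the intervals occurring as first coordinates form a chain under inclusion, and for each interval $A$ occurring as a first coordinate in $T$ there is exactly one element of $T$ of the form $(A,g)$. Let $O_T$ denote the set of intervals occurring as first coordinates in $T$; the height of $T$ is the cardinality of $O_T$. Two intervals $(a,b)$ and $(c,d)$ share an end if $a=c$ or $b=d$. A tower $T$ is strict if no two distinct intervals in $O_T$ share an end. The strict height $h_{\mathrm{strict}}(G)$ is the supremum of the heights of the strict towers of $G$ if this supremum is finite, and $h_{\mathrm{strict}}(G)=\infty$ otherwise. *)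

(* Defs.v *)
From HB Require Import structures.
From mathcomp Require Import all_boot all_order all_algebra.
From mathcomp Require Import all_classical all_reals all_analysis.

Set Implicit Arguments.
Unset Strict Implicit.
Unset Printing Implicit Defensive.

Import Order.TTheory GRing.Theory Num.Theory.
Import numFieldNormedType.Exports.

Local Open Scope classical_set_scope.
Local Open Scope group_scope.

Section Subgroups.
Variable gT : groupType.
Implicit Types G S : set gT.

Definition is_subgroup G : Prop :=
  [/\ G 1,
      forall x y, G x -> G y -> G (x * y)
    & forall x, G x -> G x^-1].

Definition generated S : set gT := smallest is_subgroup S.

Definition derived_subgroup G : set gT :=
  generated [set z | exists x y, [/\ G x, G y & z = [~ x, y]]].

Definition derived_series n G : set gT := iter n derived_subgroup G.

Definition solvable_of_degree n G : Prop :=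
  derived_series n G = [set 1] /\
  forall m, (m < n)%N -> derived_series m G <> [set 1].

End Subgroups.

(* The subset [0, 1], coerced to the type [set_type] when used as a type, so
   that it carries the subspace topology of the reals. *)
Definition unit_itv (R : realType) : set R := `[0%R, 1%R]%classic.
Arguments unit_itv : clear implicits.

Record homeo_plus (R : realType) := HomeoPlus {
  homeo_fun :> unit_itv R -> unit_itv R ;
  homeo_cts : continuous homeo_fun ;
  homeo_inv : exists g : unit_itv R -> unit_itv R,
    [/\ continuous g, cancel homeo_fun g & cancel g homeo_fun] ;
  homeo_incr : forall x y : unit_itv R,
    (\val x < \val y)%R -> (\val (homeo_fun x) < \val (homeo_fun y))%R }.
Arguments homeo_cts {R} h x : rename.
Arguments homeo_inv {R} h : rename.
Arguments homeo_incr {R} h {x y} : rename.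

Section HomeoGroup.
Variable R : realType.
Implicit Types f g h : homeo_plus R.

HB.instance Definition _ := gen_eqMixin (homeo_plus R).
HB.instance Definition _ := gen_choiceMixin (homeo_plus R).

Lemma homeo_plusP f g : (forall x, f x = g x) -> f = g.
Proof.
case: f g => [f f1 f2 f3] [g g1 g2 g3] /= /funext E; subst g.
by congr HomeoPlus; exact: Prop_irrelevance.
Qed.

Fact homeo_one_subproof : exists g : unit_itv R -> unit_itv R,
  [/\ continuous g, cancel id g & cancel g id].
Proof. by exists id; split=> // x; exact: cvg_id. Qed.

Definition homeo_one : homeo_plus R :=
  @HomeoPlus R id (fun x => @cvg_id _ (nbhs x)) homeo_one_subproof
    (fun _ _ => id).

Fact homeo_mul_cts f g : continuous (f \o g).
Proof.
move=> x; exact: continuous_comp (homeo_cts g x) (homeo_cts f (g x)).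
Qed.

Fact homeo_mul_subproof f g : exists h : unit_itv R -> unit_itv R,
  [/\ continuous h, cancel (f \o g) h & cancel h (f \o g)].
Proof.
have [f' [cf' fK f'K]] := homeo_inv f; have [g' [cg' gK g'K]] := homeo_inv g.
exists (g' \o f'); split.
- by move=> x; exact: continuous_comp (cf' x) (cg' (f' x)).
- exact: can_comp.
- exact: can_comp.
Qed.

Definition homeo_mul f g : homeo_plus R :=
  @HomeoPlus R (f \o g) (@homeo_mul_cts f g) (homeo_mul_subproof f g)
    (fun x y lt_xy => homeo_incr f (homeo_incr g lt_xy)).

Lemma homeo_inv_exists f :
  exists h, cancel (homeo_fun f) (homeo_fun h) /\
            cancel (homeo_fun h) (homeo_fun f).
Proof.
have [g [cg fK gK]] := homeo_inv f.
have incr_g (x y : unit_itv R) :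
    (\val x < \val y)%R -> (\val (g x) < \val (g y))%R.
  move=> lt_xy; rewrite ltNge le_eqVlt; apply/negP => /orP[/eqP/val_inj E|].
    by move: lt_xy; rewrite -(gK x) -(gK y) E ltxx.
  by move=> /(homeo_incr f); rewrite !gK => /(lt_trans lt_xy); rewrite ltxx.
have inv_g : exists h : unit_itv R -> unit_itv R,
    [/\ continuous h, cancel g h & cancel h g].
  by exists f; split=> //; exact: homeo_cts.
by exists (HomeoPlus cg inv_g incr_g).
Qed.

Definition homeo_invg f : homeo_plus R := sval (cid (homeo_inv_exists f)).

Fact homeo_mulA : associative homeo_mul.
Proof. by move=> f g h; apply: homeo_plusP. Qed.

Fact homeo_mul1 : left_id homeo_one homeo_mul.
Proof. by move=> f; apply: homeo_plusP. Qed.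

Fact homeo_mulr1 : right_id homeo_one homeo_mul.
Proof. by move=> f; apply: homeo_plusP. Qed.

Fact homeo_mulV : left_inverse homeo_one homeo_invg homeo_mul.
Proof.
move=> f; apply: homeo_plusP => x /=; rewrite /homeo_invg.
by case: cid => h [fK hK] /=; exact: fK.
Qed.

Fact homeo_mulrV : right_inverse homeo_one homeo_invg homeo_mul.
Proof.
move=> f; apply: homeo_plusP => x /=; rewrite /homeo_invg.
by case: cid => h [fK hK] /=; exact: hK.
Qed.

HB.instance Definition _ := isGroup.Build (homeo_plus R)
  homeo_mulA homeo_mul1 homeo_mulr1 homeo_mulV homeo_mulrV.

End HomeoGroup.

Section Towers.
Variable R : realType.
Implicit Types (G : set (homeo_plus R)) (g : homeo_plus R) (A B : set R).
Implicit Type T : set (set R * homeo_plus R).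

Definition orbit_in_R G (x : unit_itv R) : set R := [set \val (g x) | g in G].

Definition convex_hull A : set R := [set` Rhull A].

Definition is_orbital G A : Prop :=
  (exists x : unit_itv R, A = convex_hull (orbit_in_R G x)) /\
  (exists a b, [/\ A a, A b & a <> b]).

Definition is_orbital_of_elt g A : Prop := is_orbital (generated [set g]) A.

Definition signed_orbitals G : set (set R * homeo_plus R) :=
  [set p | G p.2 /\ is_orbital_of_elt p.2 p.1].

Definition tower_orbitals T : set (set R) := [set p.1 | p in T].

Definition is_tower G T : Prop :=
  [/\ T `<=` signed_orbitals G,
      total_on (tower_orbitals T) subset
    & forall A, tower_orbitals T A -> exists! g, T (A, g)].

Definition tower_height T : \bar R := counting (tower_orbitals T).

(* Orbitals are nonempty open intervals, so they determine their endpoints. *)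
Definition share_end A B : Prop :=
  exists a b c d : R,
    [/\ A = `]a, b[%classic, B = `]c, d[%classic & a = c \/ b = d].

Definition is_strict_tower G T : Prop :=
  is_tower G T /\
  forall A B, tower_orbitals T A -> tower_orbitals T B -> A <> B ->
    ~ share_end A B.

(* [counting] is +oo on infinite sets and the empty tower has height 0, so this
   is the supremum of the heights when finite and +oo otherwise, never -oo. *)
Definition strict_height G : \bar R :=
  ereal_sup [set tower_height T | T in is_strict_tower G].

End Towers.

(* Main.v *)
Require Import Defs.
From HB Require Import structures.
From mathcomp Require Import all_boot all_order all_algebra.
From mathcomp Require Import all_classical all_reals all_analysis.
From mathcomp Require Import ring.

(** The group is the affine group generated by x |-> x + 1 and x |-> T x on a
countable ordered field K in which T is infinitely large; K is the field of
rational functions over the rationals, where a function is positive when it is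
eventually positive near +oo.

Why it lives in the interval: K is a countable dense linear order without
endpoints, hence is order isomorphic to the rationals of ]0, 1[
([cantor_isomorphism]).  So K embeds increasingly into [0, 1] with dense image
([dense_embedding]), and every order automorphism of K extends to exactly one
homeomorphism of [0, 1] ([order_automorphism_extends], [homeo_eq_on_dense]).
Affine maps with positive slope are such automorphisms, and identities between
them can be checked on K.

Why the derived length is two: the commutator of two affine maps has slope 1,
and translations commute; but x + 1 and T x do not commute.

Why the strict height is infinite: conjugating x + 1 by the i-th power of T x
gives the translation by T^i, which therefore belongs to the group.  Its
orbital [level i] around the image of 0 is the hull of the integer multiples of
T^i.  When i < j all these multiples lie strictly between -T^j and T^j, and
-2T^j, 2T^j still belong to [level j]; thus [level i] stays away from both ends
of [level j].  The pairs formed by [level i] and the translation by T^i are an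
infinite strict tower. *)

Set Implicit Arguments.
Unset Strict Implicit.
Unset Printing Implicit Defensive.

Import Order.TTheory GRing.Theory Num.Theory.
Import numFieldNormedType.Exports.

Local Open Scope classical_set_scope.

(** * Countable dense orders *)

Definition dense_unbounded d (A : orderType d) : Prop :=
  [/\ forall x y : A, (x < y)%O -> exists z, (x < z < y)%O,
      forall x : A, exists y, (y < x)%O
    & forall x : A, exists y, (x < y)%O].

Definition enumerates T (e : nat -> T) : Prop := forall x, exists n, e n = x.

(** Density is what separates two nonempty finite sets, the absence of a least
or greatest element what bounds one of them; [x0] serves when both are empty. *)
Lemma finite_separation d (A : orderType d) (x0 : A) (lo hi : seq A) :
  dense_unbounded A ->
  (forall l h, l \in lo -> h \in hi -> (l < h)%O) ->
  exists c, (forall l, l \in lo -> (l < c)%O) /\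
            (forall h, h \in hi -> (c < h)%O).
Proof.
move=> [dense nomin nomax].
have max_seq (s : seq A) x :
    exists2 m, m \in x :: s & forall y, y \in x :: s -> (y <= m)%O.
  elim: s x => [|y s IHs] x.
    by exists x; rewrite ?mem_head// => z; rewrite inE => /eqP ->.
  have [m m_in m_max] := IHs y; have [le_xm|lt_mx] := leP x m.
    by exists m => [|z]; rewrite inE ?m_in ?orbT// => /predU1P[->|/m_max].
  exists x => [|z]; rewrite ?mem_head// inE => /predU1P[->//|/m_max/le_trans->//].
  exact: ltW.
have min_seq (s : seq A) x :
    exists2 m, m \in x :: s & forall y, y \in x :: s -> (m <= y)%O.
  elim: s x => [|y s IHs] x.
    by exists x; rewrite ?mem_head// => z; rewrite inE => /eqP ->.
  have [m m_in m_min] := IHs y; have [le_mx|lt_xm] := leP m x.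
    by exists m => [|z]; rewrite inE ?m_in ?orbT// => /predU1P[->|/m_min].
  exists x => [|z]; rewrite ?mem_head// inE => /predU1P[->//|/m_min].
  exact/le_trans/ltW.
case: lo => [|x lo]; case: hi => [|y hi] lo_hi.
- by exists x0.
- have [m _ m_min] := min_seq hi y; have [c lt_cm] := nomin m.
  by exists c; split=> // h /m_min; exact: lt_le_trans.
- have [m _ m_max] := max_seq lo x; have [c lt_mc] := nomax m.
  by exists c; split=> // l /m_max/le_lt_trans->.
have [l l_in l_max] := max_seq lo x; have [h h_in h_min] := min_seq hi y.
have [c /andP[lt_lc lt_ch]] := dense _ _ (lo_hi _ _ l_in h_in).
exists c; split=> z; first by move=> /l_max/le_lt_trans->.
by move=> /h_min; exact: lt_le_trans.
Qed.

(** A finite list of pairs that preserves and reflects the strict order is the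
graph of a finite partial isomorphism: by trichotomy it is also functional and
injective. *)
Definition order_matching d d' (A : orderType d) (B : orderType d')
    (s : seq (A * B)) : Prop :=
  {in s &, forall u v, (u.1 < v.1)%O = (u.2 < v.2)%O}.

(** The forth step.  The partners of the elements below [a] lie below those of
the elements above [a], and any element separating the two is a partner. *)
Lemma order_matching_extend d d' (A : orderType d) (B : orderType d') (b0 : B)
    (s : seq (A * B)) (a : A) :
  dense_unbounded B -> order_matching s -> exists b, order_matching ((a, b) :: s).
Proof.
move=> denseB ms.
have [/mapP[[a' b] ab /= ->]|a_new] := boolP (a \in map fst s).
  by exists b => u v /predU1P[->|us] /predU1P[->|vs]; apply: ms.
pose below := [seq v.2 | v <- s & (v.1 < a)%O].
pose above := [seq v.2 | v <- s & (a < v.1)%O].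
have [l h /mapP[u]|b [below_b b_above]] :=
    @finite_separation _ _ b0 below above denseB.
  rewrite mem_filter => /andP[lt_ua us] -> /mapP[v].
  rewrite mem_filter => /andP[lt_av vs] ->.
  by rewrite -(ms u v us vs); exact: lt_trans lt_av.
have key u : u \in s ->
    (u.1 < a)%O = (u.2 < b)%O /\ (a < u.1)%O = (b < u.2)%O.
  move=> us; case: (ltgtP u.1 a) => [lt_ua|lt_au|eq_ua].
  - have lt_ub : (u.2 < b)%O by apply/below_b/map_f; rewrite mem_filter lt_ua.
    by rewrite lt_ub lt_gtF.
  - have lt_bu : (b < u.2)%O by apply/b_above/map_f; rewrite mem_filter lt_au.
    by rewrite lt_bu lt_gtF.
  - by move: a_new; rewrite -eq_ua (map_f fst us).
exists b => u v /predU1P[->|us] /predU1P[->|vs] /=.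
- by rewrite !ltxx.
- by have [] := key v vs.
- by have [] := key u us.
- exact: ms.
Qed.

(** The back step is the forth step for the transposed list. *)
Lemma back_and_forth_step d d' (A : orderType d) (B : orderType d')
    (s : seq (A * B)) (a : A) (b : B) :
  dense_unbounded A -> dense_unbounded B -> order_matching s ->
  exists s', [/\ order_matching s', {subset s <= s'},
    exists b', (a, b') \in s' & exists a', (a', b) \in s'].
Proof.
move=> denseA denseB ms.
have [b' ms1] := order_matching_extend b a denseB ms.
pose swap (C D : Type) (p : C * D) := (p.2, p.1).
pose s1 := (a, b') :: s.
have ms1' : order_matching (map (@swap A B) s1).
  by move=> _ _ /mapP[u us ->] /mapP[v vs ->] /=; rewrite ms1.
have [a' ms2] := order_matching_extend a b denseA ms1'.
exists ((a', b) :: s1); split.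
- move=> u v us vs; have in2 w : w \in (a', b) :: s1 ->
      swap _ _ w \in (b, a') :: map (@swap A B) s1.
    by move=> ws; exact: (@map_f _ _ (@swap A B) ((a', b) :: s1)).
  by rewrite -(ms2 _ _ (in2 _ us) (in2 _ vs)).
- by move=> u us; rewrite !inE us !orbT.
- by exists b'; rewrite !inE eqxx orbT.
- by exists a'; rewrite mem_head.
Qed.

(** Stage [n] of the back-and-forth construction makes sure that the [n]-th
elements of both enumerations are matched, so the union of the stages is the
graph of an isomorphism. *)
Theorem cantor_isomorphism d d' (A : orderType d) (B : orderType d')
    (eA : nat -> A) (eB : nat -> B) :
  enumerates eA -> enumerates eB -> dense_unbounded A -> dense_unbounded B ->
  exists f : A -> B, {homo f : x y / (x < y)%O} /\ forall b, exists a, f a = b.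
Proof.
move=> enumA enumB denseA denseB.
pose matching := {s : seq (A * B) | order_matching s}.
have step (n : nat) (s : matching) : exists s' : matching,
    [/\ {subset sval s <= sval s'}, exists b, (eA n, b) \in sval s'
      & exists a, (a, eB n) \in sval s'].
  have [s' [ms' sub ab ba]] :=
    back_and_forth_step (eA n) (eB n) denseA denseB (svalP s).
  by exists (exist _ s' ms').
have m0 : order_matching ([::] : seq (A * B)) by [].
pose next n s := sval (cid (step n s)).
pose S := fix S n := if n is m.+1 then next m (S m) else exist _ [::] m0 : matching.
have S_step n : [/\ {subset sval (S n) <= sval (S n.+1)},
    exists b, (eA n, b) \in sval (S n.+1)
  & exists a, (a, eB n) \in sval (S n.+1)].
  by rewrite /= /next; case: cid.
have S_mono n m : (n <= m)%N -> {subset sval (S n) <= sval (S m)}.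
  elim: m => [|m IHm]; first by rewrite leqn0 => /eqP ->.
  rewrite leq_eqVlt => /predU1P[->//|/IHm sub] u /sub.
  by have [sub' _ _] := S_step m; exact: sub'.
have S_lt n m a b a' b' : (a, b) \in sval (S n) -> (a', b') \in sval (S m) ->
    (a < a')%O = (b < b')%O.
  move=> /(S_mono _ _ (leq_maxl n m)) ab /(S_mono _ _ (leq_maxr n m)) ab'.
  exact: (svalP (S (maxn n m)) _ _ ab ab').
have [f f_graph] : {f : A -> B & forall a, exists n, (a, f a) \in sval (S n)}.
  apply: (@choice _ _ (fun a b => exists n, (a, b) \in sval (S n))) => a.
  have [n <-] := enumA a; have [_ [b ab] _] := S_step n.
  by exists b; exists n.+1.
exists f; split=> [a a' lt_aa'|b].
  have [n fa] := f_graph a; have [m fa'] := f_graph a'.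
  by rewrite -(S_lt _ _ _ _ _ _ fa fa').
have [n <-] := enumB b; have [_ _ [a ab]] := S_step n.
exists a; have [m fa] := f_graph a.
case: (ltgtP (f a) (eB n)) => //.
  by rewrite -(S_lt _ _ _ _ _ _ fa ab) ltxx.
by rewrite -(S_lt _ _ _ _ _ _ ab fa) ltxx.
Qed.

(** * Extending order automorphisms to homeomorphisms of the interval *)

Section UnitInterval.
Local Open Scope ring_scope.
Variable R : realType.

Lemma unit_itvP (y : unit_itv R) : 0 <= \val y <= 1.
Proof. by have := set_valP y; rewrite /unit_itv /= in_itv. Qed.

Definition to_unit_itv (y : R) (y01 : 0 <= y <= 1) : unit_itv R.
Proof. by apply: (@exist _ _ y); rewrite inE /unit_itv /= in_itv. Defined.

Definition increasing_on_unit_itv (f : unit_itv R -> unit_itv R) : Prop :=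
  forall x y, \val x < \val y -> \val (f x) < \val (f y).

Lemma increasing_lt_iff f : increasing_on_unit_itv f ->
  forall x y, (\val (f x) < \val (f y)) = (\val x < \val y).
Proof.
move=> f_incr x y; have [/f_incr//|/f_incr/lt_gtF//|/val_inj ->] := ltgtP (\val x) (\val y).
exact: ltxx.
Qed.

(** A monotone function can only be discontinuous by jumping, and a jump would
leave a gap in its range.  The known result for real functions on a segment is
transferred to the subtype. *)
Lemma increasing_onto_continuous (f : unit_itv R -> unit_itv R) :
  increasing_on_unit_itv f -> (forall y, exists x, f x = y) -> continuous f.
Proof.
move=> f_incr f_onto.
(* The subtype carries the initial topology for its inclusion in the reals. *)
suff : continuous (fun x => \val (f x) : R) by exact: continuous_comp_initial.
apply/subspace_valL_continuousP.
set F := valL _.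
have FE x (x01 : 0 <= x <= 1) : F x = \val (f (to_unit_itv x01)).
  exact: (congr1 (@^~ (to_unit_itv x01)) (valLK _ (fun x => \val (f x) : R))).
have F_mono : {in `[0%R, 1%R] &, {mono F : x y / x <= y}}.
  move=> x y; rewrite !in_itv /= => x01 y01.
  by rewrite !FE !leNgt increasing_lt_iff.
apply: segment_inc_surj_continuous F_mono _ => y /=.
have zero01 : 0 <= (0 : R) <= 1 by rewrite lexx ler01.
have one01 : 0 <= (1 : R) <= 1 by rewrite ler01 lexx.
rewrite (FE _ zero01) (FE _ one01) in_itv /= => /andP[f0_le_y y_le_f1].
have y01 : 0 <= y <= 1.
  have /andP[f0_ge0 _] := unit_itvP (f (to_unit_itv zero01)).
  have /andP[_ f1_le1] := unit_itvP (f (to_unit_itv one01)).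
  by rewrite (le_trans f0_ge0 f0_le_y) (le_trans y_le_f1 f1_le1).
have [x fx] := f_onto (to_unit_itv y01); have x01 := unit_itvP x.
exists (\val x); first by rewrite in_itv.
rewrite (FE _ x01) (_ : to_unit_itv x01 = x) ?fx//; exact: val_inj.
Qed.

End UnitInterval.

Section Extension.
Local Open Scope ring_scope.
Variables (R : realType) (d : Order.disp_t) (A : orderType d).
Variable iota : A -> unit_itv R.
Hypothesis iota_lt : forall x y, (x < y)%O -> \val (iota x) < \val (iota y).
Hypothesis iota_dense : forall p q : unit_itv R, \val p < \val q ->
  exists x, \val p < \val (iota x) < \val q.

Lemma iota_mono x y : (\val (iota x) < \val (iota y)) = (x < y)%O.
Proof.
by have [/iota_lt//|/iota_lt/lt_gtF//|->] := ltgtP x y; exact: ltxx.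
Qed.

(** If [H y < F y], density puts some [iota (g x)] strictly in between; as both
maps take this value at [iota x], monotonicity puts [iota x] on both sides of
[y]. *)
Lemma extension_unique (g : A -> A) (F H : unit_itv R -> unit_itv R) :
  increasing_on_unit_itv F -> increasing_on_unit_itv H ->
  (forall z, exists x, g x = z) ->
  (forall x, F (iota x) = iota (g x)) -> (forall x, H (iota x) = iota (g x)) ->
  F =1 H.
Proof.
have half F1 F2 : increasing_on_unit_itv F1 -> increasing_on_unit_itv F2 ->
    (forall z, exists x, g x = z) ->
    (forall x, F1 (iota x) = iota (g x)) ->
    (forall x, F2 (iota x) = iota (g x)) ->
    forall y, \val (F1 y) <= \val (F2 y).
  move=> F1_incr F2_incr g_onto F1E F2E y; rewrite leNgt; apply/negP.
  move=> /iota_dense[z /andP[]]; have [x <-] := g_onto z.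
  rewrite -{1}F2E -F1E !increasing_lt_iff// => lt_yx /(lt_trans lt_yx).
  by rewrite ltxx.
move=> F_incr H_incr g_onto FE HE y; apply/val_inj/le_anti.
by rewrite !half.
Qed.

(** The value 0 keeps the set inhabited at the left endpoint, where no
[iota x] lies below. *)
Definition extend_set (g : A -> A) (y : unit_itv R) : set R :=
  [set r : R | r = 0 \/
    exists2 x, r = \val (iota (g x)) & \val (iota x) <= \val y].

Definition extend g y : R := sup (extend_set g y).

Lemma extend_has_sup g y : has_sup (extend_set g y).
Proof.
split; first by exists 0; left.
exists 1 => r [->|[x -> _]]; first exact: ler01.
by have /andP[] := unit_itvP (iota (g x)).
Qed.

Lemma extend_unit_itv g y : 0 <= extend g y <= 1.
Proof.
apply/andP; split; first by apply: ub_le_sup; [have [] := extend_has_sup g y|left].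
apply: ge_sup => [|r [->|[x -> _]]]; [by exists 0; left|exact: ler01|].
by have /andP[] := unit_itvP (iota (g x)).
Qed.

Definition extension g y : unit_itv R := to_unit_itv (extend_unit_itv g y).

Section Increasing.
Variable g : A -> A.
Hypothesis g_incr : {homo g : x y / (x < y)%O}.

Lemma extension_iota x : extension g (iota x) = iota (g x).
Proof.
apply: val_inj; rewrite /= /extend; apply/le_anti/andP; split; last first.
  apply: ub_le_sup; first by have [] := extend_has_sup g (iota x).
  by right; exists x.
apply: ge_sup => [|r [->|[z -> le_zx]]]; first by exists 0; left.
  by have /andP[] := unit_itvP (iota (g x)).
rewrite leNgt iota_mono; apply/negP => lt_gxz.
move: le_zx; rewrite leNgt iota_mono; case: (ltgtP x z) => // [/g_incr/lt_gtF|E].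
  by rewrite lt_gxz.
by rewrite E ltxx in lt_gxz.
Qed.

Lemma extension_le y z : \val y <= \val z -> extend g y <= extend g z.
Proof.
move=> le_yz; apply: ge_sup => [|r r_in]; first by exists 0; left.
apply: ub_le_sup; first by have [] := extend_has_sup g z.
by case: r_in => [->|[x -> /le_trans le_xy]]; [left|right; exists x => //; exact: le_xy].
Qed.

(** Strictness needs two points [iota x < iota x'] between the arguments, to
separate their images. *)
Lemma extension_increasing : increasing_on_unit_itv (extension g).
Proof.
move=> y z /iota_dense[x /andP[lt_yx /iota_dense[x' /andP[lt_xx' lt_x'z]]]].
have lt_g : \val (extension g (iota x)) < \val (extension g (iota x')).
  by rewrite !extension_iota iota_mono; apply: g_incr; rewrite -iota_mono.
by apply: (le_lt_trans (extension_le (ltW lt_yx)));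
   apply: (lt_le_trans lt_g); exact/extension_le/ltW.
Qed.

End Increasing.

(** Both the composite and the identity extend the identity of [A]. *)
Lemma extensionK g g' : {homo g : x y / (x < y)%O} ->
  {homo g' : x y / (x < y)%O} -> cancel g g' ->
  cancel (extension g) (extension g').
Proof.
move=> g_incr g'_incr gK.
apply: (@extension_unique id (extension g' \o extension g) id) => //.
- move=> x y lt_xy; apply: (extension_increasing g'_incr).
  exact: (extension_increasing g_incr).
- by move=> z; exists z.
- by move=> x /=; rewrite !extension_iota// gK.
Qed.

Theorem order_automorphism_extends g g' : {homo g : x y / (x < y)%O} ->
  {homo g' : x y / (x < y)%O} -> cancel g g' -> cancel g' g ->
  exists h : homeo_plus R, forall x, h (iota x) = iota (g x).
Proof.
move=> g_incr g'_incr gK g'K.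
have FK := extensionK g_incr g'_incr gK; have GK := extensionK g'_incr g_incr g'K.
have F_incr := extension_increasing g_incr.
have G_incr := extension_increasing g'_incr.
have F_cts : continuous (extension g).
  by apply: increasing_onto_continuous => // y; exists (extension g' y).
have G_cts : continuous (extension g').
  by apply: increasing_onto_continuous => // y; exists (extension g y).
have F_inv : exists G : unit_itv R -> unit_itv R,
    [/\ continuous G, cancel (extension g) G & cancel G (extension g)].
  by exists (extension g').
by exists (HomeoPlus F_cts F_inv F_incr) => x; exact: extension_iota.
Qed.

(** Thanks to this lemma, equalities in the homeomorphism group are computations
in the ordered set. *)
Lemma homeo_eq_on_dense (g : A -> A) (h k : homeo_plus R) :
  (forall z, exists x, g x = z) -> (forall x, h (iota x) = iota (g x)) ->
  (forall x, k (iota x) = iota (g x)) -> h = k.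
Proof.
move=> g_onto hE kE; apply: homeo_plusP.
by apply: (extension_unique (g := g)) => // x y; exact: homeo_incr.
Qed.

End Extension.

(** * Dense embeddings into the interval *)

Lemma realField_dense_unbounded (K : realFieldType) : dense_unbounded K.
Proof.
split=> [x y lt_xy|x|x].
- by exists ((x + y) / 2)%R; rewrite !midf_lt.
- by exists (x - 1)%R; rewrite ltrBlDr ltrDl ltr01.
- by exists (x + 1)%R; rewrite ltrDl ltr01.
Qed.

(** The target of the isomorphism is the rationals of ]0, 1[ rather than all
rationals, so that the embedding into the real line already lands in [0, 1]. *)
Definition rat01 := {q : rat | (0 < q < 1)%R}.
HB.instance Definition _ := SubCountable.on rat01.
HB.instance Definition _ := [SubChoice_isSubOrder of rat01 by <: with ring_display].

Definition to_rat01 (q : rat) (q01 : (0 < q < 1)%R) : rat01 := exist _ q q01.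

Lemma rat01_dense_unbounded : dense_unbounded rat01.
Proof.
have between (p q : rat) : (0 <= p -> p < q -> q <= 1 ->
    exists z : rat01, p < \val z < q)%R.
  move=> p_ge0 lt_pq q_le1; have [lt_pm lt_mq] := midf_lt lt_pq.
  have m01 : (0 < (p + q) / 2 < 1)%R.
    by rewrite (le_lt_trans p_ge0 lt_pm) (lt_le_trans lt_mq q_le1).
  by exists (to_rat01 m01); rewrite lt_pm lt_mq.
split=> [x y lt_xy|x|x]; have /andP[x_gt0 x_lt1] := valP x.
- have /andP[_ y_lt1] := valP y; have [] := between (\val x) (\val y) => //.
  + exact: ltW.
  + exact: ltW.
  + by move=> z; exists z.
- have [|||z /andP[_ lt_zx]] := between 0%R (\val x) => //; first exact: ltW.
  by exists z.
- have [|||z /andP[lt_xz _]] := between (\val x) 1%R => //; first exact: ltW.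
  by exists z.
Qed.

Lemma dense_embedding (R : realType) d (A : orderType d) (e : nat -> A) :
  enumerates e -> dense_unbounded A -> exists iota : A -> unit_itv R,
    (forall x y, (x < y)%O -> (\val (iota x) < \val (iota y))%R) /\
    (forall p q : unit_itv R, (\val p < \val q)%R ->
      exists x, (\val p < \val (iota x) < \val q)%R).
Proof.
move=> enum_e denseA.
have half01 : (0 < (1 / 2 : rat) < 1)%R by [].
pose e01 n : rat01 := odflt (to_rat01 half01) (unpickle n).
have enum_e01 : enumerates e01.
  by move=> q; exists (pickle q); rewrite /e01 pickleK.
have [f [f_incr f_onto]] :=
  cantor_isomorphism enum_e enum_e01 denseA rat01_dense_unbounded.
have f01 x : (0 <= (ratr (\val (f x)) : R) <= 1)%R.
  have /andP[f_gt0 f_lt1] := valP (f x).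
  move: f_lt1; rewrite -(ltr_rat R) rmorph1 => /ltW ->.
  by rewrite ler0q (ltW f_gt0).
exists (fun x => to_unit_itv (f01 x)); split=> [x y /f_incr|p q lt_pq].
  by rewrite /= ltr_rat.
have [r] := rat_in_itvoo lt_pq; rewrite in_itv /= => /andP[lt_pr lt_rq].
have /andP[p_ge0 _] := unit_itvP p; have /andP[_ q_le1] := unit_itvP q.
have r01 : (0 < r < 1)%R.
  rewrite -(ltr0q R) (le_lt_trans p_ge0 lt_pr) -(ltr_rat R) rmorph1.
  exact: lt_le_trans lt_rq q_le1.
have [x fx] := f_onto (to_rat01 r01).
by exists x; rewrite /= fx /= lt_pr lt_rq.
Qed.

(** * Affine groups *)

Section Generated.
Local Open Scope group_scope.
Variable gT : groupType.
Implicit Types S H : set gT.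

Lemma generated_subgroup S : is_subgroup (generated S).
Proof.
split=> [H [[]//]|x y xS yS H HS|x xS H HS].
- by have [[_ HM _] _] := HS; apply: HM; [exact: xS|exact: yS].
- by have [[_ _ HV] _] := HS; apply: HV; exact: xS.
Qed.

Lemma mem_generated S x : S x -> generated S x.
Proof. by move=> Sx H [_]; exact. Qed.

Lemma derived_subgroup_sub S H : is_subgroup H ->
  (forall x y, S x -> S y -> H [~ x, y]) -> derived_subgroup S `<=` H.
Proof.
by move=> subH comH; apply: smallest_sub => // _ [x [y [Sx Sy ->]]]; exact: comH.
Qed.

Lemma is_subgroup1 : is_subgroup [set 1 : gT].
Proof.
by split=> // [x y -> ->|x ->]; rewrite /= ?mulg1 ?invg1.
Qed.

End Generated.

Section AffineAction.
Local Open Scope ring_scope.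
Variables (R : realType) (K : realFieldType) (iota : K -> unit_itv R).
Hypothesis iota_lt : forall x y, x < y -> \val (iota x) < \val (iota y).
Hypothesis iota_dense : forall p q : unit_itv R, \val p < \val q ->
  exists x, \val p < \val (iota x) < \val q.
Implicit Types h k : homeo_plus R.

Definition acts_as h (c b : K) : Prop := forall x, h (iota x) = iota (c * x + b).

Lemma affine_exists c b : 0 < c -> exists h, acts_as h c b.
Proof.
move=> c_gt0; have c_neq0 : c != 0 by rewrite gt_eqF.
apply: (order_automorphism_extends iota_lt iota_dense
  (g' := fun x => c^-1 * (x - b))) => [x y|x y|x|x].
- by rewrite ltrD2r ltr_pM2l.
- by rewrite ltr_pM2l ?invr_gt0// ltrD2r.
- by rewrite addrK mulKf.
- by rewrite mulVKf// subrK.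
Qed.

Lemma acts_as_inj h k c b : 0 < c -> acts_as h c b -> acts_as k c b -> h = k.
Proof.
move=> c_gt0; apply: (homeo_eq_on_dense iota_dense (g := fun x => c * x + b)).
by move=> z; exists (c^-1 * (z - b)); rewrite mulVKf ?subrK// gt_eqF.
Qed.

Lemma acts_as1 : acts_as 1%g 1 0.
Proof. by move=> x; rewrite mul1r addr0. Qed.

Lemma acts_asM h k c b c' b' : acts_as h c b -> acts_as k c' b' ->
  acts_as (h * k)%g (c * c') (c * b' + b).
Proof.
move=> hE kE x; rewrite -[LHS]/(h (k (iota x))) kE hE; congr iota; ring.
Qed.

Lemma acts_asV h c b : 0 < c -> acts_as h c b -> acts_as h^-1%g c^-1 (- (c^-1 * b)).
Proof.
move=> c_gt0 hE x; have c_neq0 : c != 0 by rewrite gt_eqF.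
have {1}-> : x = c * (c^-1 * x - c^-1 * b) + b by field.
by rewrite -hE -[LHS]/((h^-1 * h)%g _) mulVg.
Qed.

Lemma acts_as_iota_inj h c b c' b' x :
  acts_as h c b -> acts_as h c' b' -> c * x + b = c' * x + b'.
Proof.
move=> hE hE'; have := hE x; rewrite hE' => E.
by case: (ltgtP (c * x + b) (c' * x + b')) => // /iota_lt; rewrite E ltxx.
Qed.

Definition affine_homeos : set (homeo_plus R) :=
  [set h | exists c b : K, 0 < c /\ acts_as h c b].

Definition translations : set (homeo_plus R) :=
  [set h | exists b, acts_as h 1 b].

Lemma affine_homeos_subgroup : is_subgroup affine_homeos.
Proof.
split=> [|h k [c [b [c0 hE]]] [c' [b' [c'0 kE]]]|h [c [b [c0 hE]]]].
- by exists 1, 0; split; [exact: ltr01|exact: acts_as1].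
- by exists (c * c'), (c * b' + b); split; [exact: mulr_gt0|exact: acts_asM].
- by exists c^-1, (- (c^-1 * b)); rewrite invr_gt0; split=> //; exact: acts_asV.
Qed.

Lemma translation_mul h k b b' : acts_as h 1 b -> acts_as k 1 b' ->
  acts_as (h * k)%g 1 (b + b').
Proof. by move=> hE kE x; rewrite (acts_asM hE kE); congr iota; ring. Qed.

Lemma translation_inv h b : acts_as h 1 b -> acts_as h^-1%g 1 (- b).
Proof. by move=> /(acts_asV ltr01) hE x; rewrite hE invr1 mul1r. Qed.

Lemma translations_subgroup : is_subgroup translations.
Proof.
split=> [|h k [b hE] [b' kE]|h [b hE]].
- by exists 0; exact: acts_as1.
- by exists (b + b'); exact: translation_mul.
- by exists (- b); exact: translation_inv.
Qed.

(** The slope is multiplicative, so it is 1 on commutators. *)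
Lemma affine_commutator h k :
  affine_homeos h -> affine_homeos k -> translations [~ h, k]%g.
Proof.
move=> [c [b [c0 hE]]] [c' [b' [c'0 kE]]].
have c_neq0 : c != 0 by rewrite gt_eqF.
have c'_neq0 : c' != 0 by rewrite gt_eqF.
have /= E := acts_asM (acts_asV c0 hE)
  (acts_asM (acts_asV c'0 kE) (acts_asM hE kE)).
move: E; set beta := (X in acts_as _ _ X) => E; exists beta => x.
rewrite E; congr (iota (_ + _)).
by field; rewrite c_neq0 c'_neq0.
Qed.

Lemma translations_commute h k :
  translations h -> translations k -> [~ h, k]%g = 1%g.
Proof.
move=> [b hE] [b' kE]; apply/eqP/commgP.
apply: (acts_as_inj ltr01 (translation_mul hE kE)).
by rewrite addrC; exact: translation_mul.
Qed.

(** * The group generated by a translation and an infinite dilation *)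

Variables (T : K) (a t : homeo_plus R).
Hypothesis T_infinite : forall n, n%:R < T.
Hypothesis aE : acts_as a 1 1.
Hypothesis tE : acts_as t T 0.

Let T_gt0 : 0 < T. Proof. exact: (T_infinite 0). Qed.

Lemma two_generated_affine : generated [set a; t] `<=` affine_homeos.
Proof.
apply: smallest_sub; first exact: affine_homeos_subgroup.
move=> h [|] ->; first by exists 1, 1; split=> //; exact: ltr01.
by exists T, 0.
Qed.

(** The generators do not commute since a (t 0) = 1 and t (a 0) = T on [K];
this settles that neither the group nor its derived subgroup is trivial. *)
Lemma two_generated_metabelian : solvable_of_degree 2 (generated [set a; t]).
Proof.
have a_in : generated [set a; t] a by apply: mem_generated; left.
have t_in : generated [set a; t] t by apply: mem_generated; right.
have not1 : [~ a, t]%g <> 1%g.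
  move=> /eqP/commgP at_comm; have := T_infinite 1.
  have := acts_asM tE aE; rewrite -at_comm => /(acts_as_iota_inj 0 (acts_asM aE tE)).
  by rewrite !(mulr0, add0r, addr0, mulr1) => <-; rewrite ltxx.
split=> [|[|[|//]] _ /=].
- apply/seteqP; split=> [|_ ->]; last first.
    by have [] := generated_subgroup [set z | exists x y,
      [/\ derived_subgroup (generated [set a; t]) x,
          derived_subgroup (generated [set a; t]) y & z = [~ x, y]%g]].
  have derT : derived_subgroup (generated [set a; t]) `<=` translations.
    apply: derived_subgroup_sub translations_subgroup _ => h k.
    move=> /two_generated_affine h_aff /two_generated_affine k_aff.
    exact: affine_commutator.
  apply: derived_subgroup_sub; first exact: is_subgroup1.
  by move=> h k /derT h_tr /derT k_tr; exact: translations_commute.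
- move=> gen1; apply: not1.
  by move: a_in; rewrite gen1 => ->; rewrite comm1g.
- move=> der1; apply: not1.
  suff : derived_subgroup (generated [set a; t]) [~ a, t]%g by rewrite der1.
  by apply: mem_generated; exists a, t.
Qed.

(** Conjugation by the dilation multiplies the length of a translation by T. *)
Lemma two_generated_translation i :
  exists h, generated [set a; t] h /\ acts_as h 1 (T ^+ i).
Proof.
elim: i => [|i [h [h_in hE]]].
  by exists a; split; [apply: mem_generated; left|rewrite expr0].
have [_ genM genV] := generated_subgroup [set a; t].
have t_in : generated [set a; t] t by apply: mem_generated; right.
exists (t * (h * t^-1))%g; split; first exact: (genM _ _ t_in (genM _ _ h_in (genV _ t_in))).
move=> x; rewrite (acts_asM tE (acts_asM hE (acts_asV T_gt0 tE))); congr iota.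
by rewrite exprS; field; rewrite gt_eqF.
Qed.

Section Tower.
Variable s : nat -> homeo_plus R.
Hypothesis sE : forall i, acts_as (s i) 1 (T ^+ i).

(** The orbital, around the image of 0, of a homeomorphism [s i] acting as the
translation by T^i. *)
Definition level i : set R := convex_hull (orbit_in_R (generated [set s i]) (iota 0)).

Lemma level_interval i : is_interval (level i).
Proof.
rewrite /level /convex_hull Rhull_smallest => x y xA yA z xzy S [intS subS].
by apply: (intS x y) => //; [exact: xA|exact: yA].
Qed.

Lemma translate_in_level i h b :
  generated [set s i] h -> acts_as h 1 b -> level i (\val (iota b)).
Proof.
move=> h_in hE; apply: sub_Rhull; exists h => //.
by rewrite hE mulr0 add0r.
Qed.

Lemma level_mem i : [/\ level i (\val (iota (T ^+ i))),
  level i (\val (iota (- T ^+ i))), level i (\val (iota (T ^+ i + T ^+ i)))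
  & level i (\val (iota (- T ^+ i + - T ^+ i)))].
Proof.
have [_ genM genV] := generated_subgroup [set s i].
have s_in : generated [set s i] (s i) by exact: mem_generated.
have siE := sE i; have sVE := translation_inv siE.
split.
- exact: translate_in_level s_in siE.
- exact: translate_in_level (genV _ s_in) sVE.
- exact: translate_in_level (genM _ _ s_in s_in) (translation_mul siE siE).
- exact: translate_in_level (genM _ _ (genV _ s_in) (genV _ s_in))
    (translation_mul sVE sVE).
Qed.

(** The powers of [s i] translate by the integer multiples of T^i; a bound on
their lengths is all that is needed to compare the levels. *)
Lemma generated_translation_bound i h : generated [set s i] h ->
  exists b n, acts_as h 1 b /\ `|b| <= T ^+ i *+ n.
Proof.
move: h; apply: smallest_sub => [|_ ->]; last first.
  by exists (T ^+ i), 1; rewrite ger0_norm// exprn_ge0// ltW.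
split.
- by exists 0, 0; rewrite normr0 mulr0n; split=> //; exact: acts_as1.
- move=> h k [b [n [hE bn]]] [b' [n' [kE bn']]].
  exists (b + b'), (n + n')%N; split; first exact: translation_mul.
  by rewrite mulrnDr (le_trans (ler_normD _ _))// lerD.
- move=> h [b [n [hE bn]]]; exists (- b), n; rewrite normrN; split=> //.
  exact: translation_inv.
Qed.

(** This is where T being infinitely large separates the levels. *)
Lemma infinite_power i j n : (i < j)%N -> T ^+ i *+ n < T ^+ j.
Proof.
move=> lt_ij; rewrite -(subnK (ltnW lt_ij)) exprD -mulr_natl ltr_pM2r ?exprn_gt0//.
rewrite -(prednK (n := j - i)) ?subn_gt0// exprS.
apply: lt_le_trans (T_infinite n) _; rewrite ler_peMr ?(ltW T_gt0)//.
by rewrite exprn_ege1// ltW// (T_infinite 1).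
Qed.

(** The hull is the smallest interval containing the orbit, and a segment is an
interval. *)
Lemma level_bound i j r : (i < j)%N -> level i r ->
  \val (iota (- T ^+ j)) <= r <= \val (iota (T ^+ j)).
Proof.
move=> lt_ij; rewrite /level /convex_hull Rhull_smallest; move: r.
change (smallest (@is_interval R) (orbit_in_R (generated [set s i]) (iota 0)) `<=`
  [set r | \val (iota (- T ^+ j)) <= r <= \val (iota (T ^+ j))]).
apply: smallest_sub => [x y /andP[lx _] /andP[_ yu] z /andP[xz zy]|_ [h h_in <-]].
  by rewrite /= (le_trans lx xz) (le_trans zy yu).
have [b [n [hE bn]]] := generated_translation_bound h_in.
have := le_lt_trans bn (infinite_power n lt_ij); rewrite ltr_norml => /andP[lb bu].
by rewrite /= hE mulr0 add0r !ltW// iota_lt.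
Qed.

Lemma level_proper i j : (i < j)%N -> level i `<=` level j.
Proof.
move=> lt_ij r /(level_bound lt_ij) r_in; have [pos neg _ _] := level_mem j.
exact: level_interval neg pos _ r_in.
Qed.

Let lt_T2 j : T ^+ j < T ^+ j + T ^+ j.
Proof. by rewrite ltrDl exprn_gt0. Qed.

(** These two points belong to [level j], by [level_mem]: on either side
[level j] reaches strictly further than [level i]. *)
Lemma level_escape i j : (i < j)%N ->
  ~ level i (\val (iota (T ^+ j + T ^+ j))) /\
  ~ level i (\val (iota (- T ^+ j + - T ^+ j))).
Proof.
move=> lt_ij; split=> /(level_bound lt_ij); rewrite !leNgt !iota_mono//.
  by rewrite lt_T2 andbF.
by rewrite -opprD ltrN2 lt_T2.
Qed.

Lemma level_lt_neq i j : (i < j)%N -> level i <> level j.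
Proof.
move=> lt_ij E; have [_ _ + _] := level_mem j; rewrite -E.
by have [] := level_escape lt_ij.
Qed.

Lemma level_inj : injective level.
Proof.
by move=> i j E; case: (ltngtP i j) => // /level_lt_neq; rewrite E.
Qed.

(** If the intervals had a common right end, the point 2T^j of the larger one
would lie to the left of this end, and to the right of the point T^i of the
smaller one, hence in the smaller one.  The left end is symmetric. *)
Lemma level_lt_share_end i j : (i < j)%N -> ~ share_end (level i) (level j).
Proof.
move=> lt_ij [x [y [z [w [Ei Ej]]]]].
have [pos_out neg_out] := level_escape lt_ij.
have [pos_i neg_i _ _] := level_mem i; have [_ _ pos_j neg_j] := level_mem j.
have lt_Ti : T ^+ i < T ^+ j + T ^+ j.
  exact: lt_trans (infinite_power 1 lt_ij) (lt_T2 j).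
move: pos_out neg_out pos_i neg_i pos_j neg_j; rewrite Ei Ej /= !in_itv /=.
move=> pos_out neg_out /andP[xi _] /andP[_ iy] /andP[_ jw] /andP[zj _].
case=> [xz|yw].
- apply: neg_out; rewrite xz zj (lt_trans _ iy)// iota_lt//.
  by rewrite -opprD ltrN2.
- apply: pos_out; rewrite yw jw andbT (lt_trans xi)// iota_lt//.
Qed.

Lemma share_end_sym (A B : set R) : share_end A B -> share_end B A.
Proof.
move=> [x [y [z [w [EA EB E]]]]]; exists z, w, x, y; split=> //.
by case: E => ->; [left|right].
Qed.

Definition level_tower : set (set R * homeo_plus R) :=
  [set p | exists i, p = (level i, s i)].

Lemma level_tower_orbitals : tower_orbitals level_tower = range level.
Proof.
apply/seteqP; split=> [_ [_ [i ->] <-]|_ [i _ <-]]; first by exists i.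
by exists (level i, s i) => //; exists i.
Qed.

Lemma level_tower_strict G : (forall i, G (s i)) -> is_strict_tower G level_tower.
Proof.
move=> sG; split; last first.
  move=> A B; rewrite level_tower_orbitals => -[i _ <-] [j _ <-] neq_ij.
  case: (ltngtP i j) => [|lt_ji|eq_ij]; first exact: level_lt_share_end.
    by move=> /share_end_sym; exact: level_lt_share_end.
  by rewrite eq_ij in neq_ij.
split.
- move=> _ [i ->]; split; first exact: sG.
  split; first by exists (iota 0).
  have [pos neg _ _] := level_mem i.
  exists (\val (iota (T ^+ i))), (\val (iota (- T ^+ i))); split=> // E.
  have : - T ^+ i < T ^+ i by rewrite gtrN// exprn_gt0.
  by move=> /iota_lt; rewrite E ltxx.
- move=> A B; rewrite level_tower_orbitals => -[i _ <-] [j _ <-].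
  case: (ltngtP i j) => [|lt_ji|->]; [|by right; exact: level_proper|by left].
  by left; exact: level_proper.
- move=> A; rewrite level_tower_orbitals => -[i _ <-].
  exists (s i); split; first by exists i.
  by move=> h [j [/level_inj -> ->]].
Qed.

Lemma level_tower_height : tower_height level_tower = +oo%E.
Proof.
rewrite /tower_height level_tower_orbitals /counting asboolF//.
move=> fin; apply: infinite_nat.
have -> : [set: nat] = level @^-1` range level by apply/seteqP; split=> // i _; exists i.
apply: finite_preimage fin => i j _ _; exact: level_inj.
Qed.

End Tower.

Lemma two_generated_strict_height : strict_height (generated [set a; t]) = +oo%E.
Proof.
have [s s_prop] := choice two_generated_translation.
apply/eqP; rewrite -leye_eq; apply: ereal_sup_ubound.
exists (level_tower s); last by apply: level_tower_height => i; have [] := s_prop i.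
by apply: level_tower_strict => i; have [] := s_prop i.
Qed.

End AffineAction.

(** * The rational functions, ordered by their behaviour at infinity *)

Section RationalFunctions.
Local Open Scope ring_scope.

Definition ratfun := {fraction {poly rat}}.
HB.instance Definition _ := GRing.Field.on ratfun.

Implicit Types (x y : ratfun) (p q : {poly rat}).

Definition ratfun_frac p q : ratfun := FracField.tofrac p / FracField.tofrac q.

(** Numerator and denominator of a representative of the quotient class. *)
Lemma ratfunP x : exists p q, q != 0 /\ x = ratfun_frac p q.
Proof.
elim/quotW: x => x; exists (frac x).1, (frac x).2; split; first exact: denom_ratioP.
have d_neq0 : FracField.tofrac (frac x).2 != 0 by rewrite tofrac_eq0 denom_ratioP.
apply: (mulIf d_neq0); rewrite divfK//; unlock FracField.tofrac.
rewrite -[LHS]FracField.pi_mul; apply/eqmodP; rewrite /= /FracField.mulf FracField.equivfE.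
by rewrite !numden_Ratio ?(oner_neq0, mulr1, denom_ratioP)// mulrC.
Qed.

Lemma ratfun_enumerable : exists e : nat -> ratfun, enumerates e.
Proof.
exists (fun n => if unpickle n is Some (p, q) then ratfun_frac p q else 0).
move=> x; have [p [q [_ ->]]] := ratfunP x.
by exists (pickle (p, q)); rewrite pickleK.
Qed.

(** A quotient of polynomials has, near +oo, the sign of the quotient of their
leading coefficients; asking for a positive leading coefficient in the
denominator normalizes the representation. *)
Definition ratfun_ge0 x : bool :=
  `[< exists p q, [/\ 0 <= lead_coef p, 0 < lead_coef q & x = ratfun_frac p q] >].

(** Leading terms of the same sign cannot cancel. *)
Lemma lead_coefD_ge0 p q :
  0 <= lead_coef p -> 0 <= lead_coef q -> 0 <= lead_coef (p + q).
Proof.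
move=> p_ge0 q_ge0; case: (ltngtP (size p) (size q)) => [lt_pq|lt_qp|eq_pq].
- by rewrite lead_coefDr.
- by rewrite lead_coefDl.
have [->|p_neq0] := eqVneq p 0; first by rewrite add0r.
have p_gt0 : 0 < lead_coef p by rewrite lt_def lead_coef_eq0 p_neq0.
have pq_gt0 : 0 < (p + q)`_(size p).-1.
  by rewrite coefD {2}eq_pq -!lead_coefE ltr_wpDr.
have -> : lead_coef (p + q) = (p + q)`_(size p).-1.
  rewrite lead_coefE; congr (_`_ _.-1); apply/eqP; rewrite eqn_leq.
  rewrite (leq_trans (size_polyD _ _)) ?geq_max ?eq_pq ?leqnn//=.
  rewrite -eq_pq -(prednK (n := size p)) ?size_poly_gt0// ltnNge.
  by apply/negP => /(nth_default 0) E; rewrite E ltxx in pq_gt0.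
exact: ltW.
Qed.

Lemma ratfun_ge0D x y : ratfun_ge0 x -> ratfun_ge0 y -> ratfun_ge0 (x + y).
Proof.
move=> /asboolP[p [q [p_ge0 q_gt0 ->]]] /asboolP[p' [q' [p'_ge0 q'_gt0 ->]]].
apply/asboolP; exists (p * q' + p' * q), (q * q'); split.
- by apply: lead_coefD_ge0; rewrite lead_coefM mulr_ge0// ltW.
- by rewrite lead_coefM mulr_gt0.
have tq_neq0 r : 0 < lead_coef r -> FracField.tofrac r != 0.
  by move=> r_gt0; rewrite tofrac_eq0 -lead_coef_eq0 gt_eqF.
by rewrite /ratfun_frac tofracD !tofracM addf_div ?tq_neq0.
Qed.

Lemma ratfun_ge0M x y : ratfun_ge0 x -> ratfun_ge0 y -> ratfun_ge0 (x * y).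
Proof.
move=> /asboolP[p [q [p_ge0 q_gt0 ->]]] /asboolP[p' [q' [p'_ge0 q'_gt0 ->]]].
apply/asboolP; exists (p * p'), (q * q'); rewrite !lead_coefM mulr_ge0// mulr_gt0//.
by rewrite /ratfun_frac !tofracM mulf_div.
Qed.

Lemma ratfun_ge0_anti x : ratfun_ge0 x -> ratfun_ge0 (- x) -> x = 0.
Proof.
move=> /asboolP[p [q [p_ge0 q_gt0 ->]]] /asboolP[p' [q' [p'_ge0 q'_gt0]]].
have tq_neq0 r : 0 < lead_coef r -> FracField.tofrac r != 0.
  by move=> r_gt0; rewrite tofrac_eq0 -lead_coef_eq0 gt_eqF.
rewrite /ratfun_frac -mulNr => /eqP; rewrite eqr_div ?tq_neq0//.
rewrite -tofracN -!tofracM tofrac_eq => /eqP/(congr1 lead_coef).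
rewrite !lead_coefM lead_coefN => E.
have /eqP : lead_coef p * lead_coef q' = 0.
  apply/le_anti/andP; split; last by rewrite mulr_ge0// ltW.
  by rewrite -oppr_ge0 -mulNr E mulr_ge0// ltW.
rewrite mulf_eq0 (gt_eqF q'_gt0) orbF lead_coef_eq0 => /eqP ->.
by rewrite tofrac0 mul0r.
Qed.

Lemma ratfun_ge0_total x : ratfun_ge0 x || ratfun_ge0 (- x).
Proof.
have [p [q [q_neq0 ->]]] := ratfunP x.
(* Changing both signs makes the denominator positive near +oo. *)
wlog q_gt0 : p q q_neq0 / 0 < lead_coef q.
  move=> H; have [/H->//|] := ltP 0 (lead_coef q).
  rewrite le_eqVlt lead_coef_eq0 (negPf q_neq0) /= => q_lt0.
  have -> : ratfun_frac p q = ratfun_frac (- p) (- q).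
    by rewrite /ratfun_frac !tofracN invrN mulrNN.
  by apply: H; rewrite ?oppr_eq0// lead_coefN oppr_gt0.
have [p_ge0|p_lt0] := leP 0 (lead_coef p).
  by apply/orP; left; apply/asboolP; exists p, q.
apply/orP; right; apply/asboolP; exists (- p), q.
by rewrite lead_coefN oppr_ge0 ltW// /ratfun_frac tofracN mulNr.
Qed.

Definition ratfun_le x y : bool := ratfun_ge0 (y - x).
Definition ratfun_lt x y : bool := (y != x) && ratfun_le x y.
Definition ratfun_norm x : ratfun := if ratfun_ge0 x then x else - x.

Fact ratfun_le0_add x y :
  ratfun_le 0 x -> ratfun_le 0 y -> ratfun_le 0 (x + y).
Proof. by rewrite /ratfun_le !subr0; exact: ratfun_ge0D. Qed.

Fact ratfun_le0_mul x y :
  ratfun_le 0 x -> ratfun_le 0 y -> ratfun_le 0 (x * y).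
Proof. by rewrite /ratfun_le !subr0; exact: ratfun_ge0M. Qed.

Fact ratfun_le0_anti x : ratfun_le 0 x -> ratfun_le x 0 -> x = 0.
Proof. by rewrite /ratfun_le subr0 sub0r; exact: ratfun_ge0_anti. Qed.

Fact ratfun_sub_ge0 x y : ratfun_le 0 (y - x) = ratfun_le x y.
Proof. by rewrite /ratfun_le subr0. Qed.

Fact ratfun_le0_total x : ratfun_le 0 x || ratfun_le x 0.
Proof. by rewrite /ratfun_le subr0 sub0r; exact: ratfun_ge0_total. Qed.

Fact ratfun_normN x : ratfun_norm (- x) = ratfun_norm x.
Proof.
rewrite /ratfun_norm opprK; have [x_ge0|] := boolP (ratfun_ge0 x); last first.
  by move=> nx; have := ratfun_ge0_total x; rewrite (negPf nx) /= => ->.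
by case: ifP => // /(ratfun_ge0_anti x_ge0) ->; rewrite oppr0.
Qed.

Fact ratfun_ge0_norm x : ratfun_le 0 x -> ratfun_norm x = x.
Proof. by rewrite /ratfun_le subr0 /ratfun_norm => ->. Qed.

HB.instance Definition _ := Num.IntegralDomain_isLeReal.Build ratfun
  ratfun_le0_add ratfun_le0_mul ratfun_le0_anti ratfun_sub_ge0 ratfun_le0_total
  ratfun_normN ratfun_ge0_norm (fun _ _ => erefl).

Definition ratfunX : ratfun := FracField.tofrac 'X.

Lemma ratfunX_infinite n : n%:R < ratfunX.
Proof.
rewrite -subr_gt0 lt_def; apply/andP; split.
  rewrite /ratfunX -(rmorph_nat (@FracField.tofrac _)) subr_eq0 tofrac_eq -subr_eq0.
  by rewrite -polyC_natr -size_poly_eq0 size_XsubC.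
rewrite -[0 <= _]/(ratfun_ge0 _) subr0; apply/asboolP.
exists ('X - n%:R%:P), 1; rewrite lead_coefXsubC lead_coef1; split=> //.
by rewrite /ratfun_frac tofrac1 divr1 tofracB polyC_natr rmorph_nat.
Qed.

End RationalFunctions.

(** * An affine group of infinite strict height *)

Theorem theorem1p6 (R : realType) :
  exists Gamma : set (homeo_plus R),
    [/\ is_subgroup Gamma,
        solvable_of_degree 2 Gamma,
        exists f g : homeo_plus R, Gamma = generated [set f; g]
      & strict_height Gamma = +oo%E].
Proof.
have [e enum_e] := ratfun_enumerable.
have [iota [iota_lt iota_dense]] :=
  dense_embedding R enum_e (@realField_dense_unbounded ratfun).
have X_gt0 : (0 < ratfunX)%R by exact: (ratfunX_infinite 0).
have [a aE] := affine_exists iota_lt iota_dense 1%R ltr01.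
have [t tE] := affine_exists iota_lt iota_dense 0%R X_gt0.
exists (generated [set a; t]); split.
- exact: generated_subgroup.
- exact: (two_generated_metabelian iota_lt iota_dense ratfunX_infinite aE tE).
- by exists a, t.
- exact: (two_generated_strict_height iota_lt ratfunX_infinite aE tE).
Qed.
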